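(* If $q=3^{2\ell}$ for some positive integer $\ell$, then the intersection density of $\mathrm{PGL}_2(q)$ with its action on the $3$-subsets of $\{1,\dots,q+1\}$ is $\frac{q}{3}$.
   Context: $\mathrm{PGL}_2(q)$ acts naturally on the $q+1$ points of the projective line over $\mathbb{F}_q$ (identified with $\{1,\dots,q+1\}$), and hence on its $3$-subsets. For a finite group $G$ acting transitively on a finite set $V$, a subset $\mathcal{F}\subseteq G$ is intersecting if for any $g,h\in\mathcal{F}$ there is $v\in V$ with $g(v)=h(v)$. The intersection density of $G$ in this action is $\rho(G)=\max\{ |\mathcal{F}|\,|V|/|G| : \mathcal{F}\subseteq G \text{ intersecting}\}$. Here $V$ is the set of $3$-subsets of $\{1,\dots,q+1\}$. *)

(* Defs.v *)
From mathcomp Require Import all_boot all_order all_fingroup all_algebra.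
From mathcomp Require Import center mxrepresentation mxabelem.

Set Implicit Arguments.
Unset Strict Implicit.
Unset Printing Implicit Defensive.

Import Order.TTheory GRing.Theory Num.Theory GroupScope.

Local Open Scope ring_scope.

(* [to v g] is the image of v under g, as a right action. For a left action
   g(v) = to v g^-1, so the intersecting sets for the two conventions correspond
   under A |-> A^-1 and have the same sizes. *)
Definition intersecting (aT : finGroupType) (D : {set aT}) (rT : finType)
    (to : action D rT) (V : {set rT}) (A : {set aT}) : bool :=
  [forall g in A, forall h in A, exists v in V, to v g == to v h].

(* The empty set is intersecting and contributes 0, so the default value 0 of
   the maximum is attained. *)
Definition intersection_density (aT : finGroupType) (D : {set aT})
    (rT : finType) (to : action D rT) (G : {set aT}) (V : {set rT}) : rat :=
  \big[Num.max/0]_(A : {set aT} | (A \subset G) && intersecting to V A)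
    ((#|A| * #|V|)%N%:R / #|G|%:R).

Section ProjectiveLine.

Variable F : finFieldType.

Definition PGL2 := ('GL_2[F] / 'Z('GL_2[F]))%G.

(* A point is a 1-dimensional subspace of F^2, given as its set of vectors. *)
Definition proj_line : {set {set 'rV[F]_2}} :=
  [set rowg v | v : 'rV[F]_2 & v != 0].

(* Induced by the action v |-> v *m g on row vectors. Modulo the centre, only
   the sets of vectors fixed by every scalar matrix are really acted upon, which
   includes all points of the line, see [PGL2_actE]; [%%] makes the action
   trivial on the other sets. *)
Definition PGL2_act : action PGL2 {set 'rV[F]_2} :=
  (('MR (GLrepr F 1%N))^* %% 'Z('GL_2[F]))%act.

Definition triples : {set {set {set 'rV[F]_2}}} :=
  [set S : {set {set 'rV[F]_2}} | (S \subset proj_line) && (#|S| == 3%N)].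

Definition PGL2_act_triples : action PGL2 {set {set 'rV[F]_2}} :=
  (PGL2_act^*)%act.

Lemma GL_act_rowg (v : 'rV[F]_2) (g : {'GL_2[F]}) :
  (('MR (GLrepr F 1%N))^*)%act (rowg v) g = rowg (v *m GLval g).
Proof.
apply/setP=> u; apply/imsetP/idP => [[w] | ].
  rewrite !mem_rowg => wv ->; rewrite /= mx_repr_actE ?inE //.
  exact: submxMr.
rewrite mem_rowg => /submxP[a ->]; exists (a *m v).
  by rewrite mem_rowg submxMl.
by rewrite /= mx_repr_actE ?inE // mulmxA.
Qed.

Lemma GL2_center_scalar (z : {'GL_2[F]}) :
  z \in 'Z('GL_2[F]) -> exists2 a, a != 0 & GLval z = a%:M.
Proof.
move=> /centerP[_ zC].
have cE (e : 'M[F]_2) : e *m e = 0 -> GLval z *m e = e *m GLval z.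
  move=> ee; have Ue : (1%:M + e : 'M[F]_2) \in unitmx.
    suff /mulmx1_unit[] : (1%:M + e) *m (1%:M - e) = 1%:M by [].
    by rewrite mulmxBr mulmx1 mulmxDl mul1mx ee addr0 addrK.
  have := congr1 val (zC (insubd (1%g : {'GL_2[F]}) (1%:M + e)) (in_setT _)).
  rewrite /= insubdK; last by rewrite unitmxE in Ue.
  rewrite /GRing.mul /= mulmxDl mulmxDr mul1mx mulmx1.
  exact: addrI.
have ee i j : i != j -> delta_mx i j *m delta_mx i j = 0 :> 'M[F]_2.
  by move=> ij; rewrite mul_delta_mx_0 // eq_sym.
have mulr_delta (A : 'M[F]_2) i j k l :
    (A *m delta_mx i j) k l = A k i * (l == j)%:R.
  rewrite mxE (bigD1 i) //= mxE eqxx big1 ?addr0 // => m /negPf im.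
  by rewrite mxE im mulr0.
have mull_delta (A : 'M[F]_2) i j k l :
    (delta_mx i j *m A) k l = (k == i)%:R * A j l.
  rewrite mxE (bigD1 j) //= mxE eqxx andbT big1 ?addr0 // => m /negPf im.
  by rewrite mxE im andbF mul0r.
have offd (i j : 'I_2) : i != j -> GLval z i j = 0.
  move=> ij; have ji : j != i by rewrite eq_sym.
  have /matrixP/(_ i i) := cE _ (ee j i ji).
  by rewrite mulr_delta mull_delta eqxx (negPf ij) mulr1 mul0r.
have diag (i j : 'I_2) : GLval z i i = GLval z j j.
  have [-> // | ij] := eqVneq i j.
  have /matrixP/(_ i j) := cE _ (ee i j ij).
  by rewrite mulr_delta mull_delta !eqxx mulr1 mul1r.
have zE : GLval z = (GLval z 0 0)%:M.
  apply/matrixP => i j; rewrite mxE; have [<- | ij] := eqVneq i j.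
    by rewrite mulr1n.
  by rewrite mulr0n offd.
exists (GLval z 0 0) => //; apply: contraTneq (GL_unitmx z) => z0.
by rewrite [X in X \in _]zE z0 raddf0 unitmxE det0 unitr0.
Qed.

Lemma PGL2_actE (v : 'rV[F]_2) (g : {'GL_2[F]}) :
  PGL2_act (rowg v) (coset 'Z('GL_2[F]) g) = rowg (v *m GLval g).
Proof.
have gG : g \in 'GL_2[F] by rewrite inE.
rewrite -GL_act_rowg /PGL2_act /= modactE //.
  by apply: (subsetP (normal_norm (center_normal [group of 'GL_2[F]]))).
apply/afixP => z /setIP[_ /GL2_center_scalar[a a0 za]].
rewrite GL_act_rowg za mul_mx_scalar.
by apply/eq_rowg/eqmx_scale.
Qed.

Lemma card_proj_line : #|proj_line| = #|F|.+1.
Proof.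
have q1 : (0 < #|F|.-1)%N.
  by have := card_finNzRing_gt1 F; case: #|F| => [|[]].
have fib L : L \in proj_line ->
    \sum_(v : 'rV[F]_2 | (v != 0) && (rowg v == L)) 1%N = #|F|.-1.
  case/imsetP=> w w0 ->; rewrite inE in w0.
  have -> : #|F|.-1 = #|rowg w :\ 0|.
    have := cardsD1 0 (rowg w).
    by rewrite mem_rowg sub0mx card_rowg rank_rV w0 expn1 => ->.
  rewrite sum1dep_card; apply: eq_card => v; rewrite !inE.
  case v0: (v == 0) => //=; apply/eqP/idP => vw.
    by rewrite -mem_rowg -vw mem_rowg.
  apply/eq_rowg/eqmxP; rewrite vw.
  by rewrite -(geq_leqif (mxrank_leqif_sup vw)) !rank_rV w0 v0.
have := card_rowg (1%:M : 'M[F]_2); rewrite rowg1 mxrank1 (cardsD1 0) inE add1n.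
have -> : #|[set: 'rV[F]_2] :\ 0| = (#|proj_line| * #|F|.-1)%N.
  rewrite -sum1_card (eq_bigl (fun v : 'rV[F]_2 => v != 0)); last first.
    by move=> v; rewrite !inE andbT.
  rewrite (partition_big (fun v : 'rV[F]_2 => rowg v) (mem proj_line)) /=.
    by rewrite (eq_bigr _ fib) sum_nat_const.
  by move=> v v0; apply: imset_f; rewrite inE.
move=> E; apply/eqP; rewrite -(eqn_pmul2r q1); apply/eqP.
move: E q1; case: #|F| => // n /= E _.
by apply: succn_inj; rewrite E -mulnn !mulSn mulnS addSn.
Qed.

End ProjectiveLine.

(* Main.v *)
Require Import Defs.
From HB Require Import structures.
From mathcomp Require Import all_boot all_order all_fingroup all_algebra.
From mathcomp Require Import center mxrepresentation mxabelem.
From mathcomp Require Import cyclic finfield ring.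

Set Implicit Arguments.
Unset Strict Implicit.
Unset Printing Implicit Defensive.

Import Order.TTheory GRing.Theory Num.Theory GroupScope.
Local Open Scope ring_scope.

(**
  Write q for #|F|.  There are #|PGL2| / 6 triples, so the density is one sixth
  of the size of a largest intersecting set, and the theorem says that this
  size is 2q.

  The maps t |-> b + t and t |-> b - t of the affine line form an intersecting
  set with 2q elements: any two of them have the same image of a suitable
  affine line {m, m + d, m - d} over the prime field
  ([signed_translations_intersecting]).

  For the upper bound, translate an intersecting set so that it contains 1.
  An element that fixes a triple permutes the three points of a frame.  In
  characteristic 3, and since -1 is a square because q is an even power of 3,
  such an element can be scaled to a matrix of determinant 1 whose trace is in
  the prime field F3 ([fix_triple_F3_trace]).  An intersecting set A thus
  lifts to a set S of 2 #|A| matrices of determinant 1, closed under opposite,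
  in which the quotient of any two elements has its trace in F3.  As
  det (s - t) = 2 - tr (s t^-1) when det s = det t = 1, this says that the
  quadratic form det takes values in F3 on all differences of elements of S,
  a condition that is invariant under s |-> g s h when det g det h = 1.  It
  remains to see that #|S| <= 4q ([card_F3_clique]).

  If no difference of distinct elements of S is singular, elements that are not
  opposite are orthogonal for the polar form of det, and #|S| <= q + 4.
  Otherwise one moves S so that it contains 1 and the transvection
  [1 1; 0 1].  Polarity with these two puts the trace and the lower left entry
  of each s in S into F3.  If that lower left entry is always 0, then S lies
  in the Borel subgroup and its diagonals can only be +-(1, 1) and
  +-(i, -i), whence #|S| <= 4q.  If not, a further conjugation makes all of
  S rational over F3, up to one common factor in the difference of the diagonal
  entries; then S embeds into the vectors of norm 1 of a quaternary quadratic
  form over F3, and there are at most 30 <= 36 <= 4q of these.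
*)

(** * Matrices of size two, by entries *)

Section Mx2.

Variable R : comNzRingType.
Implicit Types (a b c d : R) (M N : 'M[R]_2).

Definition mx2 a b c d : 'M[R]_2 :=
  \matrix_(i, j) if i == 0 then if j == 0 then a else b
                 else if j == 0 then c else d.

Lemma mx2_eta M : M = mx2 (M 0 0) (M 0 1) (M 1 0) (M 1 1).
Proof.
have ord2 (i : 'I_2) : i = 0 \/ i = 1.
  by case: i => [[|[|//]] ?]; [left | right]; apply: val_inj.
by apply/matrixP=> i j; rewrite mxE; case: (ord2 i) (ord2 j) => -> [] ->.
Qed.

Lemma mx2P M : exists a b c d, M = mx2 a b c d.
Proof.
by exists (M 0 0), (M 0 1), (M 1 0), (M 1 1); apply: mx2_eta.
Qed.

Lemma mx2_inj a b c d a' b' c' d' :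
  mx2 a b c d = mx2 a' b' c' d' -> [/\ a = a', b = b', c = c' & d = d'].
Proof.
by move/matrixP=> E; split; [have := E 0 0 | have := E 0 1 | have := E 1 0 |
  have := E 1 1]; rewrite !mxE.
Qed.

Lemma mul_mx2 a b c d a' b' c' d' :
  mx2 a b c d *m mx2 a' b' c' d' =
  mx2 (a * a' + b * c') (a * b' + b * d') (c * a' + d * c') (c * b' + d * d').
Proof.
rewrite [LHS]mx2_eta; congr mx2; rewrite !mxE big_ord_recl big_ord1 !mxE //=.
Qed.

Lemma scalar_mx2 a : a%:M = mx2 a 0 0 a.
Proof. by rewrite [LHS]mx2_eta !mxE. Qed.

Lemma opp_mx2 a b c d : - mx2 a b c d = mx2 (- a) (- b) (- c) (- d).
Proof. by rewrite [LHS]mx2_eta !mxE. Qed.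

Lemma sub_mx2 a b c d a' b' c' d' :
  mx2 a b c d - mx2 a' b' c' d' = mx2 (a - a') (b - b') (c - c') (d - d').
Proof. by rewrite [LHS]mx2_eta !mxE. Qed.

Lemma scale_mx2 k a b c d :
  k *: mx2 a b c d = mx2 (k * a) (k * b) (k * c) (k * d).
Proof. by rewrite [LHS]mx2_eta !mxE. Qed.

Lemma det_mx2 a b c d : \det (mx2 a b c d) = a * d - b * c.
Proof.
rewrite (expand_det_row _ 0) big_ord_recl big_ord1 /cofactor !det_mx11 !mxE /=.
by rewrite /bump /= expr0 expr1 mul1r mulN1r mulrN.
Qed.

Lemma trace_mx2 a b c d : \tr (mx2 a b c d) = a + d.
Proof. by rewrite /mxtrace big_ord_recl big_ord1 !mxE. Qed.

End Mx2.

(** Any nonscalar matrix is the companion matrix of its characteristic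
    polynomial in the basis v, v x, for some vector v that is not an
    eigenvector: one of the vectors (1, 0), (0, 1), (1, 1) will do. *)
Lemma mx2_companion (K : fieldType) (x : 'M[K]_2) : ~~ is_scalar_mx x ->
  exists2 g, g \in unitmx & g *m x = mx2 0 1 (- \det x) (\tr x) *m g.
Proof.
have [a [b [c [d ->]]]] := mx2P x => nsc.
suff [v1 [v2 v0]] : exists v1 v2,
    v1 * (v1 * b + v2 * d) - v2 * (v1 * a + v2 * c) != 0.
  exists (mx2 v1 v2 (v1 * a + v2 * c) (v1 * b + v2 * d)).
    by rewrite unitmxE det_mx2 unitfE.
  rewrite !mul_mx2 det_mx2 trace_mx2; congr mx2; ring.
have [b0 | bn] := eqVneq b 0; last first.
  by exists 1, 0; rewrite !mul0r !mul1r addr0 subr0.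
have [c0 | cn] := eqVneq c 0; last first.
  by exists 0, 1; rewrite !mul0r !mul1r !add0r oppr_eq0.
exists 1, 1; rewrite b0 c0 !mul1r add0r addr0 subr_eq0.
apply: contraNneq nsc => da; apply/is_scalar_mxP; exists a.
by rewrite b0 c0 da scalar_mx2.
Qed.

Lemma card_le_size (T : finType) (A : {set T}) (s : seq T) :
  {subset A <= s} -> (#|A| <= size s)%N.
Proof.
move=> As; rewrite cardE uniq_leq_size ?enum_uniq // => x.
by rewrite mem_enum => /As.
Qed.

(** * Sets of matrices whose differences have determinant in the prime field *)

Section Char3.

Variables (F : finFieldType) (ch3 : 3%N \in [pchar F]).

(** The prime field, as the fixed points of the Frobenius map. *)
Definition F3 := [qualify a x : F | x ^+ 3 == x].

Let three0 : 3%:R = 0 :> F.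
Proof. exact: pcharf0. Qed.

(** The form in which 3 = 0 can be combined with [ring]: z is the difference
    of the two sides divided by 3, computed with integral coefficients. *)
Lemma eq_mod3 (z x y : F) : x = y + 3%:R * z -> x = y.
Proof. by rewrite three0 mul0r addr0. Qed.

Fact F3_subring : subring_closed F3.
Proof.
split=> [|x y|x y]; rewrite !qualifE ?expr1n // => /eqP hx /eqP hy.
  apply/eqP; rewrite -[RHS](congr2 (fun a b => a - b) hx hy).
  by apply: (@eq_mod3 (x * y ^+ 2 - x ^+ 2 * y)); ring.
by rewrite exprMn hx hy.
Qed.

HB.instance Definition _ := GRing.isSubringClosed.Build F (has_quality 1 F3)
  F3_subring.

Lemma F3P (x : F) : x \is a F3 -> [\/ x = 0, x = 1 | x = -1].
Proof.
rewrite qualifE -subr_eq0.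
have -> : x ^+ 3 - x = x * (x - 1) * (x + 1) by ring.
rewrite !mulf_eq0 subr_eq0 addr_eq0 -orbA => /or3P[] /eqP ->.
- by constructor 1.
- by constructor 2.
by constructor 3.
Qed.

Lemma F3_nat (x : F) : x \is a F3 -> exists2 n, (n < 3)%N & x = n%:R.
Proof.
case/F3P=> ->; [by exists 0%N | by exists 1%N | exists 2 => //].
by apply: (@eq_mod3 (-1)); ring.
Qed.

Lemma F3_sqr1 (x : F) : x \is a F3 -> x != 0 -> x ^+ 2 = 1.
Proof. by case/F3P=> -> //; rewrite ?eqxx // ?sqrrN expr1n. Qed.

Lemma F3_divl (x y : F) : x \is a F3 -> x != 0 -> x * y \is a F3 -> y \is a F3.
Proof.
move=> Fx x0 Fxy.
have -> : y = x * (x * y) by rewrite mulrA -expr2 F3_sqr1 ?mul1r.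
exact: rpredM.
Qed.

(** A clique, closed under opposite, of the graph on SL2 in which s and t are
    joined when the trace of s t^-1 is in F3. The condition is put on det (s -
    t) = 2 - tr (s t^-1), which makes no use of inverses. *)
Definition F3_clique (S : {set 'M[F]_2}) :=
  [/\ {in S, forall s, \det s = 1}, {in S, forall s, - s \in S} &
      {in S &, forall s t, \det (s - t) \is a F3}].

(** Multiplication by g and h rescales det by det g det h = 1.  So any element
    of a clique can be moved to 1, and cliques can be conjugated. *)
Lemma F3_clique_transport S (g h : 'M[F]_2) :
  \det g * \det h = 1 -> F3_clique S ->
  let S' := [set g *m s *m h | s in S] in F3_clique S' /\ #|S'| = #|S|.
Proof.
move=> gh1 [S1 SN SS]; have gu : g \in unitmx.
  rewrite unitmxE unitfE; apply: contra_eq_neq gh1 => ->.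
  by rewrite mul0r eq_sym oner_eq0.
have hu : h \in unitmx.
  rewrite unitmxE unitfE; apply: contra_eq_neq gh1 => ->.
  by rewrite mulr0 eq_sym oner_eq0.
have dE s : \det (g *m s *m h) = \det s by rewrite !det_mulmx mulrAC gh1 mul1r.
split; last first.
  by apply/card_imset/(inj_comp (can_inj (mulmxK hu)) (can_inj (mulKmx gu))).
split=> [_ /imsetP[s sS ->] | _ /imsetP[s sS ->]
        | _ _ /imsetP[s sS ->] /imsetP[t tS ->]].
- by rewrite dE S1.
- by rewrite -mulNmx -mulmxN; apply: imset_f; apply: SN.
by rewrite -mulmxBl -mulmxBr dE SS.
Qed.

(** The polar form of det takes values in F3 on a clique S, as det itself does
    on S and on the differences of its elements. *)
Lemma F3_clique_polar S a b c d a' b' c' d' : F3_clique S ->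
  mx2 a b c d \in S -> mx2 a' b' c' d' \in S ->
  a * d' + d * a' - b * c' - c * b' \is a F3.
Proof.
move=> [S1 _ SS] xS yS; have := SS _ _ xS yS.
have := S1 _ xS; have := S1 _ yS; rewrite sub_mx2 !det_mx2 => e1 e2 H.
have -> : a * d' + d * a' - b * c' - c * b' =
    (a * d - b * c) + (a' * d' - b' * c') -
    ((a - a') * (d - d') - (b - b') * (c - c')) by ring.
by rewrite e1 e2 rpredB // rpredD ?rpred1.
Qed.

Lemma F3_clique_det S a b c d :
  F3_clique S -> mx2 a b c d \in S -> a * d - b * c = 1.
Proof. by move=> [S1 _ _] /S1; rewrite det_mx2. Qed.

Lemma F3_clique_tr S a b c d : F3_clique S -> 1%:M \in S -> mx2 a b c d \in S ->
  a + d \is a F3.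
Proof.
rewrite scalar_mx2 => cS S1 /(F3_clique_polar cS S1).
by rewrite !mul0r !subr0 !mul1r addrC.
Qed.

Implicit Types (S : {set 'M[F]_2}).
Variables (im : F) (im2 : im ^+ 2 = -1).

Lemma sqrt_N1E (x : F) : x ^+ 2 = -1 -> x = im \/ x = - im.
Proof.
by move/eqP; rewrite -im2 eqf_sqr => /orP[] /eqP; [left | right].
Qed.

(** The diagonal of a triangular matrix in a clique is (a, a^-1) with
    a + a^-1 in F3: a trace of 0 forces a = +- im, and a trace of 1 or -1 makes
    the characteristic polynomial the square (X + 1)^2 or (X - 1)^2.  With four
    diagonals and q upper right entries, there are at most 4q matrices. *)
Lemma card_F3_clique_borel S : F3_clique S -> 1%:M \in S ->
  {in S, forall s : 'M[F]_2, s 1 0 = 0} -> (#|S| <= 4 * #|F|)%N.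
Proof.
move=> cS S1 S0; pose us := [:: 1; -1; im; - im].
have /card_le_size : {subset S <= [seq mx2 e b 0 e^-1 | e <- us, b <- enum F]}.
  move=> s; have [a [b [c [d ->]]]] := mx2P s => sS.
  have := S0 _ sS; rewrite mxE /= => c0; move: sS; rewrite c0 => sS {c c0}.
  have := F3_clique_det cS sS; rewrite mulr0 subr0 => ad1.
  have a0 : a != 0.
    by apply: contra_eq_neq ad1 => ->; rewrite mul0r eq_sym oner_eq0.
  have dE : d = a^-1 by apply: (mulfI a0); rewrite ad1 divff.
  have aE : a \in us.
    have sq0 (k : F) : (a + k) ^+ 2 = 0 -> a = - k.
      by move/eqP; rewrite expf_eq0 /= addr_eq0 => /eqP.
    rewrite !inE; case/F3P: (F3_clique_tr cS S1 sS) => tE.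
    - have /sqrt_N1E : a ^+ 2 = -1.
        rewrite expr2 -ad1 -mulrN; congr (_ * _).
        by apply/eqP; rewrite -addr_eq0 tE.
      by case=> ->; rewrite eqxx ?orbT.
    - suff /sq0 -> : (a + 1) ^+ 2 = 0 by rewrite eqxx orbT.
      apply: (@eq_mod3 a).
      transitivity (a * (a + d) - a * d + 1 + 2 * a); first by ring.
      by rewrite tE ad1; ring.
    suff /sq0 -> : (a + -1) ^+ 2 = 0 by rewrite opprK eqxx.
    apply: (@eq_mod3 (- a)).
    transitivity (a * (a + d) - a * d + 1 - 2 * a); first by ring.
    by rewrite tE ad1; ring.
  have bF : b \in enum F by rewrite mem_enum.
  by have := allpairs_f (fun e b => mx2 e b 0 e^-1) aE bF; rewrite dE.
by rewrite size_allpairs /= -cardE.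
Qed.

(** The solutions in F3^4 of t^2 + m k^2 - e c = 1, with digits 0, 1, 2 for
    the elements of F3 and 2 for -1, so that they can be counted by
    computation. *)
Definition norm_one_codes (m : nat) : seq (nat * nat * nat * nat) :=
  let r := iota 0 3 in
  [seq x <- [seq (x.1, x.2, y.1, y.2) | x <- [seq (t, k) | t <- r, k <- r],
      y <- [seq (e, c) | e <- r, c <- r]] |
    let: (t, k, e, c) := x in (t * t + m * (k * k) + 2 * (e * c)) %% 3 == 1]%N.

(** There are 30 solutions for m = 1 (elliptic form) and 24, the order of SL2
    over F3, for m = 2 (hyperbolic form). *)
Lemma size_norm_one_codes m :
  (m == 1%N) || (m == 2) -> (size (norm_one_codes m) <= 36)%N.
Proof. by case/orP=> /eqP ->; vm_compute. Qed.

(** Let D s be the difference of the diagonal entries of s.  Polarity shows that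
    the products D s * D t are in F3.  Hence all D s are F3-multiples of one d0
    whose square is +-1, and s is determined by four coordinates in F3: its
    trace, its two other entries, and D s / d0.  In these coordinates det s = 1
    is one of the equations whose solutions are [norm_one_codes]. *)
Lemma card_F3_clique_rational S : F3_clique S -> 1%:M \in S ->
  {in S, forall s : 'M[F]_2, s 0 1 \is a F3} ->
  {in S, forall s : 'M[F]_2, s 1 0 \is a F3} -> (#|S| <= 36)%N.
Proof.
move=> cS S1 Sb Sc.
pose D (s : 'M[F]_2) := s 1 1 - s 0 0.
have DD : {in S &, forall s t, D s * D t \is a F3}.
  move=> s t; have [a [b [c [d ->]]]] := mx2P s.
  have [a' [b' [c' [d' ->]]]] := mx2P t.
  move=> sS tS; have P := F3_clique_polar cS sS tS.
  have Ts := F3_clique_tr cS S1 sS; have Tt := F3_clique_tr cS S1 tS.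
  have := Sb _ sS; have := Sc _ sS; have := Sb _ tS; have := Sc _ tS.
  rewrite /D !mxE /= => Fc' Fb' Fc Fb.
  have -> : (d - a) * (d' - a') =  (a + d) * (a' + d') -
      ((a * d' + d * a' - b * c' - c * b') + b * c' + c * b') *+ 2.
    by ring.
  apply: rpredB; first exact: rpredM.
  by apply/rpredMn/rpredD; [apply: rpredD => // |]; apply: rpredM.
have [d0 [m [mE d0E DE]]] : exists d0 : F, exists m : nat,
    [/\ (m == 1%N) || (m == 2), m%:R = - d0 ^+ 2 &
        {in S, forall s, exists2 k, k \is a F3 & D s = k * d0}].
  have [/exists_inP[s sS Ds0] | /exists_inPn D0] :=
    boolP [exists s in S, D s != 0].
    have e2 : D s ^+ 2 * D s ^+ 2 = 1.
      by rewrite -expr2 F3_sqr1 ?expf_neq0 // expr2 DD.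
    have Fe : D s ^+ 2 \is a F3 by rewrite expr2 DD.
    (* m codes - D s ^+ 2, and 2 codes -1 *)
    exists (D s), (if D s ^+ 2 == 1 then 2%N else 1%N).
    split; first by case: ifP.
      have := F3P Fe; have [-> _ | e1] := eqVneq (D s ^+ 2) 1.
        by apply: (@eq_mod3 1); ring.
      have e0 : D s ^+ 2 != 0 by rewrite expf_neq0.
      case=> e; last by rewrite e opprK.
        by rewrite e eqxx in e0.
      by rewrite e eqxx in e1.
    move=> t tS; exists (D t * D s * D s ^+ 2); first by rewrite rpredM ?DD.
    by rewrite -mulrA -exprSr -mulrA -exprS (exprD _ 2 2) e2 mulr1.
  exists 1, 2%N; split=> //; first by apply: (@eq_mod3 1); ring.
  move=> s sS; exists 0; rewrite ?rpred0 // mul0r; apply/eqP.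
  by have := D0 s sS; rewrite negbK.
(* since 1 / 2 = -1, the diagonal entries of s are t + D s and t - D s for
   t = - \tr s *)
pose mx (x : nat * nat * nat * nat) : 'M[F]_2 := let: (t, k, e, c) := x in
  mx2 (t%:R + k%:R * d0) e%:R c%:R (t%:R - k%:R * d0).
apply: leq_trans (size_norm_one_codes mE); rewrite -(size_map mx).
apply: card_le_size.
move=> s sS; have [k0 /F3_nat[k k3 ->] Ds] := DE s sS.
have /F3_nat[e e3 eE] := Sb s sS; have /F3_nat[c c3 cE] := Sc s sS.
move: eE cE sS Ds; have [a [b [b' [d ->]]]] := mx2P s.
rewrite /D !mxE /= => -> -> sS Dk {b b'}.
have [t t3 tE] : exists2 t, (t < 3)%N & - (a + d) = t%:R.
  by apply: F3_nat; rewrite rpredN (F3_clique_tr cS S1 sS).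
have aE : a = t%:R + k%:R * d0.
  by rewrite -tE -Dk; apply: (@eq_mod3 a); ring.
have dE : d = t%:R - k%:R * d0.
  by rewrite -tE -Dk; apply: (@eq_mod3 d); ring.
have code_mod : ((t * t + m * (k * k) + 2 * (e * c)) %% 3 == 1)%N.
  set n := (_ + _)%N; have : n%:R = 1 :> F.
    rewrite !natrD !natrM d0E -[RHS](F3_clique_det cS sS) aE dE.
    by apply: (@eq_mod3 (e%:R * c%:R)); ring.
  rewrite -(GRing.natr_mod_pchar ch3); have := ltn_pmod n (isT : (0 < 3)%N).
  case: (n %% 3)%N => [|[|[|//]]] // _ /eqP; first by rewrite eq_sym oner_eq0.
  by rewrite mulr2n -subr_eq0 addrK oner_eq0.
rewrite aE dE; apply/mapP; exists (t, k, e, c) => //.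
rewrite mem_filter code_mod /=.
have digit n : (n < 3)%N -> n \in iota 0 3 by rewrite mem_iota.
have tk := allpairs_f pair (digit t t3) (digit k k3).
have ec := allpairs_f pair (digit e e3) (digit c c3).
exact: (allpairs_f (fun x y => (x.1, x.2, y.1, y.2)) tk ec).
Qed.

(** Polarity with 1 and with the transvection u puts the trace and the lower
    left entry of each element into F3. If some x has a nonzero lower left
    entry, conjugation by an upper unitriangular matrix, which commutes with
    u, makes the diagonal of x constant; then x has entries in F3, and
    polarity with x puts the upper right entries into F3 as well. *)
Lemma card_F3_clique_unipotent S : (9 <= #|F|)%N -> F3_clique S ->
  1%:M \in S -> mx2 1 1 0 1 \in S -> (#|S| <= 4 * #|F|)%N.
Proof.
move=> q9 cS S1 Su.
have S10 T : F3_clique T -> 1%:M \in T -> mx2 1 1 0 1 \in T ->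
    {in T, forall s : 'M_2, s 1 0 \is a F3}.
  move=> cT T1 Tu s; have [a [b [c [d ->]]]] := mx2P s => sT; rewrite mxE /=.
  have := rpredB (F3_clique_tr cT T1 sT) (F3_clique_polar cT Tu sT).
  by congr (_ \is a F3); ring.
have [/exists_inP[x xS x0] | /exists_inPn S0] :=
  boolP [exists s in S, s 1 0 != 0]; last first.
  by apply: card_F3_clique_borel => // s /S0; rewrite negbK => /eqP.
have [p [b [r [w xE]]]] := mx2P x; rewrite {}xE mxE /= in xS x0.
(* conjugation by g adds k r to the first diagonal entry and subtracts it from
   the second one; they agree for 2 k r = w - p, that is, k r = p - w *)
pose k := (p - w) / r; pose g := mx2 1 k 0 1; pose h := mx2 1 (- k) 0 1.
have gh1 : \det g * \det h = 1 by rewrite !det_mx2; ring.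
have [] := F3_clique_transport gh1 cS; set T := [set _ | _ in _] => cT <-.
have T1 : 1%:M \in T.
  apply/imsetP; exists 1%:M => //.
  by rewrite !scalar_mx2 !mul_mx2; congr mx2; ring.
have Tu : mx2 1 1 0 1 \in T.
  apply/imsetP; exists (mx2 1 1 0 1) => //; rewrite !mul_mx2; congr mx2; ring.
suff [y [z Tx]] : exists y, exists z, mx2 y z r y \in T.
  have Fr : r \is a F3 by have := S10 T cT T1 Tu _ Tx; rewrite mxE.
  have Fy : y \is a F3.
    have := F3_clique_tr cT T1 Tx; rewrite -rpredN; congr (_ \is a F3).
    by apply: (@eq_mod3 (- y)); ring.
  have Fz : z \is a F3.
    apply: (F3_divl Fr x0); have -> : r * z = y * y - (y * y - z * r) by ring.
    by rewrite (F3_clique_det cT Tx) rpredB ?rpred1 ?rpredM.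
  apply: leq_trans (leq_trans (isT : 36 <= 4 * 9)%N _); last first.
    by rewrite leq_mul2l q9.
  apply: card_F3_clique_rational => // [s sT|]; last exact: S10.
  have := S10 T cT T1 Tu _ sT; have [a' [b' [c' [d' sE]]]] := mx2P s.
  rewrite sE !mxE /= in sT * => Fc.
  have := F3_clique_polar cT Tx sT; have := F3_clique_tr cT T1 sT => Ft Fp.
  apply: (F3_divl Fr x0).
  have -> : r * b' = y * (a' + d') - z * c' -
      (y * d' + y * a' - z * c' - r * b') by ring.
  by rewrite rpredB // rpredB // rpredM.
exists (p + k * r), ((p + k * r) * - k + (b + k * w)).
apply/imsetP; exists (mx2 p b r w) => //; rewrite !mul_mx2.
have kr : k * r = p - w by rewrite mulrVK ?unitfE.
congr mx2; [ring | ring | ring |].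
rewrite [RHS](_ : _ = w - k * r); last by ring.
by rewrite kr; apply: (@eq_mod3 (p - w)); ring.
Qed.

(** If P is the polar form at (s, t), then det (s - t) = 2 - P and
    det (s + t) = 2 + P.  As P is in F3, both are nonzero only for P = 0. *)
Lemma F3_clique_orthogonal S a b c d a' b' c' d' : F3_clique S ->
  {in S &, forall s t, s != t -> \det (s - t) != 0} ->
  mx2 a b c d \in S -> mx2 a' b' c' d' \in S ->
  mx2 a' b' c' d' != mx2 a b c d -> mx2 a' b' c' d' != - mx2 a b c d ->
  a * d' + d * a' - b * c' - c * b' = 0.
Proof.
move=> cS Sdet sS tS ts tNs; have [S1 SN _] := cS.
have detE : \det (mx2 a' b' c' d' - mx2 a b c d) =
    - 1 - (a * d' + d * a' - b * c' - c * b').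
  rewrite sub_mx2 det_mx2; apply: (@eq_mod3 1).
  transitivity ((a' * d' - b' * c') + (a * d - b * c) -
                (a * d' + d * a' - b * c' - c * b')).
    by ring.
  by rewrite (F3_clique_det cS sS) (F3_clique_det cS tS); ring.
have detNE : \det (mx2 a' b' c' d' - - mx2 a b c d) =
    - 1 + (a * d' + d * a' - b * c' - c * b').
  rewrite opp_mx2 sub_mx2 det_mx2; apply: (@eq_mod3 1).
  transitivity ((a' * d' - b' * c') + (a * d - b * c) +
                (a * d' + d * a' - b * c' - c * b')).
    by ring.
  by rewrite (F3_clique_det cS sS) (F3_clique_det cS tS); ring.
have := Sdet _ _ tS sS ts; have := Sdet _ _ tS (SN _ sS) tNs.
rewrite detE detNE; case/F3P: (F3_clique_polar cS sS tS) => -> //.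
  by rewrite addNr eqxx.
by rewrite subrr eqxx.
Qed.

(** Elements that are neither equal nor opposite are orthogonal. An x in S
    other than 1 and -1 thus has trace 0 and can be conjugated to [0 1; -1 0].
    The elements other than +-1 and +-x are orthogonal to both, which makes
    them [a b; b -a] with -1 = a^2 + b^2 = (a + im b) (a - im b). They are
    determined by a + im b, so there are at most q of them. *)
Lemma card_F3_clique_semisimple S :
  (9 <= #|F|)%N -> F3_clique S -> 1%:M \in S ->
  {in S &, forall s t, s != t -> \det (s - t) != 0} -> (#|S| <= 4 * #|F|)%N.
Proof.
move=> q9 cS S1 Sdet.
have [/exists_inP[x xS] | /exists_inPn S0] :=
    boolP [exists s in S, (s != 1%:M) && (s != - 1%:M)]; last first.
  have /card_le_size : {subset S <= [:: 1%:M; - 1%:M : 'M[F]_2]}.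
    by move=> s /S0; rewrite negb_and !negbK !inE.
  move/leq_trans; apply; rewrite (leq_trans (isT : 2 <= 4 * 9)%N) //.
  by rewrite leq_mul2l q9.
case/andP=> x1 xN1.
have trx : \tr x = 0.
  move: xS x1 xN1; have [a [b [c [d ->]]]] := mx2P x.
  rewrite trace_mx2 scalar_mx2 => xS x1 xN1.
  have S1' := S1; rewrite scalar_mx2 in S1'.
  by rewrite -[RHS](F3_clique_orthogonal cS Sdet S1' xS x1 xN1); ring.
have detx : \det x = 1 by case: cS => S1' _ _; apply: S1'.
have nscx : ~~ is_scalar_mx x.
  apply/is_scalar_mxP=> -[a xE]; move: trx detx.
  rewrite xE scalar_mx2 trace_mx2 det_mx2.
  move=> a2 /eqP; have -> : a = 0.
    by apply: (@eq_mod3 a); rewrite add0r -[LHS]addr0 -a2; ring.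
  by rewrite !mul0r subr0 eq_sym oner_eq0.
have [g gu] := mx2_companion nscx; rewrite detx trx => gx.
have gh1 : \det g * \det (invmx g) = 1 by rewrite -det_mulmx mulmxV ?det1.
have [] := F3_clique_transport gh1 cS; set T := [set _ | _ in _] => cT <-.
have Tdet : {in T &, forall s t, s != t -> \det (s - t) != 0}.
  move=> _ _ /imsetP[s sS ->] /imsetP[t tS ->] st.
  rewrite -mulmxBl -mulmxBr !det_mulmx mulrAC gh1 mul1r Sdet //.
  by apply: contraNneq st => ->.
have T1 : 1%:M \in T by apply/imsetP; exists 1%:M; rewrite ?mulmx1 ?mulmxV.
have Tx : mx2 0 1 (-1) 0 \in T.
  by apply/imsetP; exists x; rewrite // gx -mulmxA mulmxV ?mulmx1.
(* the matrix [a b; b -a] with a + im b = n and a - im b = - n^-1 *)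
pose y n := mx2 (n^-1 - n) (im * (n + n^-1)) (im * (n + n^-1)) (n - n^-1).
have /card_le_size/leq_trans : {subset T <=
    [:: 1%:M; - 1%:M; mx2 0 1 (-1) 0; - mx2 0 1 (-1) 0] ++
    [seq y n | n <- enum F]}.
  move=> s sT; rewrite mem_cat -implyNb; apply/implyP.
  rewrite !inE !negb_or => /and4P[]; move: sT.
  have [a [b [c [d ->]]]] := mx2P s; rewrite (scalar_mx2 1) in T1 *.
  move=> sT s1 sN1 sx sNx.
  have t0 := F3_clique_orthogonal cT Tdet T1 sT s1 sN1.
  have bc := F3_clique_orthogonal cT Tdet Tx sT sx sNx.
  have dE : d = - a by rewrite -[RHS]addr0 -t0; ring.
  have cE : c = b by rewrite -[LHS]addr0 -bc; ring.
  have := F3_clique_det cT sT; rewrite {}dE {}cE => det1.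
  have nK : - (a - im * b) * (a + im * b) = 1.
    transitivity (- a ^+ 2 + im ^+ 2 * b ^+ 2); first by ring.
    by rewrite im2 -[RHS]det1; ring.
  have n0 : a + im * b != 0.
    by apply: contra_eq_neq nK => ->; rewrite mulr0 eq_sym oner_eq0.
  have nV : (a + im * b)^-1 = - (a - im * b).
    by rewrite -[RHS]mulr1 -(divff n0) mulrA nK mul1r.
  apply/mapP; exists (a + im * b); first by rewrite mem_enum.
  have bE : b = im * (a + im * b + (a + im * b)^-1).
    rewrite nV; transitivity (im ^+ 2 * (2 * b)); last by ring.
    by rewrite im2; apply: (@eq_mod3 b); ring.
  rewrite /y [_^-1 + _]addrC -bE nV; congr mx2; last 1 first.
  - by apply: (@eq_mod3 (- a)); ring.
  by apply: (@eq_mod3 a); ring.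
apply; rewrite size_cat size_map -cardE /= (leq_trans (n := #|F| + #|F|)) //.
  by rewrite leq_add2r (leq_trans _ q9).
by rewrite addnn -mul2n leq_mul2r orbT.
Qed.

(** If s and t are distinct with s - t singular, then (s - t) t^-1 is nilpotent
    and nonzero, so S t^-1 can be conjugated to contain [1 1; 0 1]. *)
Lemma card_F3_clique S : (9 <= #|F|)%N -> F3_clique S -> (#|S| <= 4 * #|F|)%N.
Proof.
move=> q9 cS; have [S1 _ _] := cS.
have tr1 t : t \in S -> \det (1%:M : 'M[F]_2) * \det (invmx t) = 1.
  by move=> /S1 t1; rewrite det1 mul1r det_inv t1 invr1.
have tu t : t \in S -> t \in unitmx.
  by move=> /S1; rewrite unitmxE => ->; rewrite unitr1.
have one_in t : t \in S -> 1%:M \in [set 1%:M *m s *m invmx t | s in S].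
  by move=> tS; apply/imsetP; exists t; rewrite // mul1mx mulmxV ?tu.
have [/exists_inP[s sS /exists_inP[t tS /andP[st det0]]] | Sdet] :=
  boolP [exists s in S, exists t in S, (s != t) && (\det (s - t) == 0)];
    last first.
  have [-> | [t tS]] := set_0Vmem S; first by rewrite cards0.
  have [] := F3_clique_transport (tr1 t tS) cS; have := one_in t tS.
  set T := [set _ | _ in _] => T1 cT <-; apply: card_F3_clique_semisimple => //.
  move=> _ _ /imsetP[x xS ->] /imsetP[y yS ->] xy.
  rewrite -mulmxBl -mulmxBr !det_mulmx mulrAC tr1 // mul1r.
  apply: contra Sdet => xy0; apply/exists_inP; exists x => //.
  apply/exists_inP; exists y => //.
  by rewrite xy0 andbT; apply: contraNneq xy => ->.
have [] := F3_clique_transport (tr1 t tS) cS; have := one_in t tS.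
set T := [set _ | _ in _] => T1 cT <-.
pose u := s *m invmx t.
have uT : u \in T by apply/imsetP; exists s; rewrite ?mul1mx.
have nE : u - 1%:M = (s - t) *m invmx t by rewrite mulmxBl mulmxV ?tu.
have n_det : \det (u - 1%:M) = 0 by rewrite nE det_mulmx (eqP det0) mul0r.
have n_tr : \tr (u - 1%:M) = 0.
  have [T1' _ _] := cT; move: n_det (T1' _ uT).
  have [a [b [c [d ->]]]] := mx2P u.
  rewrite scalar_mx2 sub_mx2 !det_mx2 trace_mx2 => e1 e2.
  rewrite -[RHS]oppr0 -e1; transitivity (a + d - 1 - 1 - (a * d - b * c - 1)).
    by rewrite e2; ring.
  ring.
have n_nsc : ~~ is_scalar_mx (u - 1%:M).
  apply: contra st => /is_scalar_mxP[a aE].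
  have a0 : a = 0.
    move: n_tr; rewrite aE mxtrace_scalar => a2.
    by apply: (@eq_mod3 a); rewrite add0r -[LHS]addr0 -a2; ring.
  have iu : invmx t \in unitmx by rewrite unitmx_inv tu.
  rewrite -subr_eq0; apply/eqP; apply: (can_inj (mulmxK iu)).
  by rewrite -nE aE a0 raddf0 mul0mx.
have [g gu] := mx2_companion n_nsc; rewrite n_det n_tr oppr0 => gn.
have gh1 : \det g * \det (invmx g) = 1 by rewrite -det_mulmx mulmxV ?det1.
have [] := F3_clique_transport gh1 cT; set T' := [set _ | _ in _] => cT' <-.
apply: card_F3_clique_unipotent => //.
  by apply/imsetP; exists 1%:M; rewrite ?mulmx1 ?mulmxV.
apply/imsetP; exists u => //.
rewrite -[u](subrK 1%:M) mulmxDr gn mulmxDl mulmx1 mulmxV // -mulmxA.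
rewrite mulmxV // mulmx1.
apply/eqP; rewrite -subr_eq; apply/eqP.
by rewrite scalar_mx2 sub_mx2 subrr !subr0.
Qed.
End Char3.

(** * Points of the projective line in coordinates *)

Section Lines.
Variable F : finFieldType.
Implicit Types (v w : 'rV[F]_2).

Definition row2 (x y : F) : 'rV[F]_2 := \row_j if j == 0 then x else y.

Lemma row2P v : exists x y, v = row2 x y.
Proof.
exists (v 0 0), (v 0 1); apply/rowP=> -[[|[|//]] ltj]; rewrite mxE;
  by congr (v _ _); apply: val_inj.
Qed.

Lemma row2_eq0 x y : (row2 x y == 0) = (x == 0) && (y == 0).
Proof.
apply/eqP/andP=> [E | [/eqP-> /eqP->]].
  have := congr1 (fun v : 'rV_2 => v 0 0) E.
  by have := congr1 (fun v : 'rV_2 => v 0 1) E; rewrite !mxE /= => -> ->.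
by apply/rowP=> j; rewrite !mxE if_same.
Qed.

Lemma mul_row2 x y a b c d :
  row2 x y *m mx2 a b c d = row2 (x * a + y * c) (x * b + y * d).
Proof.
apply/rowP=> j; rewrite !mxE big_ord_recl big_ord1 !mxE /=.
by case: ifP.
Qed.

Lemma rowg_row2 x y x' y' : row2 x y != 0 -> row2 x' y' != 0 ->
  (rowg (row2 x y) == rowg (row2 x' y')) = (x * y' == y * x').
Proof.
move=> v0 w0; apply/eqP/eqP=> [E | E].
  have := mem_rowg (row2 x' y') (row2 x y); rewrite -E mem_rowg submx_refl.
  case/esym/sub_rVP=> k /rowP kE; have := kE 0; have := kE 1.
  by rewrite !mxE /= => -> ->; ring.
have sub x1 y1 x2 y2 : row2 x1 y1 != 0 -> x1 * y2 = y1 * x2 ->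
    (row2 x2 y2 <= row2 x1 y1)%MS.
  rewrite row2_eq0 negb_and => v1 e; apply/sub_rVP.
  have [x10 | x1n] := eqVneq x1 0.
    rewrite x10 eqxx /= in v1 e; exists (y2 / y1); apply/rowP=> j; rewrite !mxE.
    have -> : x2 = 0 by apply: (mulfI v1); rewrite -e mulr0 mul0r.
    by case: ifP => _; rewrite ?x10 ?mulr0 ?divfK.
  exists (x2 / x1); apply/rowP=> j; rewrite !mxE; case: ifP => _.
    by rewrite divfK.
  by apply: (mulfI x1n); rewrite e mulrA mulrCA divff // mulr1 mulrC.
have E' : x' * y = y' * x by rewrite mulrC -E mulrC.
by apply/eqP; rewrite eqEsubset !rowgS (sub _ _ _ _ w0 E') (sub _ _ _ _ v0 E).
Qed.

Lemma rowg_mulr_inj v w (P : 'M[F]_2) : P \in unitmx ->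
  rowg (v *m P) = rowg (w *m P) -> rowg v = rowg w.
Proof.
move=> Pu /eqP; rewrite eqEsubset !rowgS !submxMfree ?row_free_unit //.
by rewrite -!rowgS -eqEsubset => /eqP.
Qed.

End Lines.

(** * Elements that fix a triple *)

Section Triples.
Variables (F : finFieldType) (ch3 : 3%N \in [pchar F]).
Variables (im : F) (im2 : im ^+ 2 = -1).
Let three0 : 3%:R = 0 :> F.
Proof. exact: pcharf0. Qed.

(** For M invertible: some multiple of M has determinant 1 and trace in F3. *)
Definition projective_F3_trace (M : 'M[F]_2) :=
  exists l c, [/\ c \is a F3 F, \det M = l ^+ 2 & \tr M = l * c].

(** The hypotheses say that each of (1, 0), (0, 1), (1, 1) is mapped to a
    multiple of one of these three. Of the 27 patterns, 21 contradict det !=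
    0. The others are the permutations of the frame, all of them matrices over
    F3 up to a scalar: the identity and the 3-cycles have determinant l^2 and
    trace l or -l, as 2 = -1, and transpositions have trace 0 and determinant
    - k^2 = (im k)^2. *)
Lemma frame_perm_F3_trace (p q r s : F) : p * s - q * r != 0 ->
  [\/ q = 0, p = 0 | p = q] -> [\/ s = 0, r = 0 | r = s] ->
  [\/ q + s = 0, p + r = 0 | p + r = q + s] ->
  projective_F3_trace (mx2 p q r s).
Proof.
move=> D0.
have F0 : 0 \is a F3 F by rewrite qualifE expr0n.
have F1 : 1 \is a F3 F by rewrite qualifE expr1n.
have FN1 : -1 \is a F3 F by rewrite qualifE exprNn expr1n mulr1 -signr_odd.
(* the equation x = y is meant for the third hypothesis; k, z, w are the
   coefficients with which it enters the determinant and the trace *)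
have inv k x y : x = y -> p * s - q * r = k * (x - y) ->
    projective_F3_trace (mx2 p q r s).
  by move=> -> E; rewrite E subrr mulr0 eqxx in D0.
have rot l c z w t x y : x = y -> c \is a F3 F ->
    p * s - q * r = l ^+ 2 + z * (x - y) ->
    p + s = l * c + w * (x - y) + 3%:R * t ->
    projective_F3_trace (mx2 p q r s).
  move=> ->; rewrite subrr !mulr0 !addr0 three0 mul0r addr0 => Fc D T.
  by exists l, c; rewrite det_mx2 trace_mx2.
have flip k z w x y : x = y ->
    p * s - q * r = - k ^+ 2 + z * (x - y) -> p + s = w * (x - y) ->
    projective_F3_trace (mx2 p q r s).
  move=> ->; rewrite subrr !mulr0 addr0 => D T; exists (im * k), 0.
  by rewrite det_mx2 trace_mx2 T D exprMn im2 mulN1r mulr0.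
case=> e1 [] e2 [] e3.
- by apply: (inv 0 0 0) => //; rewrite ?e1 ?e2; ring.
- by apply: (inv 0 0 0) => //; rewrite ?e1 ?e2; ring.
- by apply: (inv 0 0 0) => //; rewrite ?e1 ?e2; ring.
- by apply: (inv p _ _ e3); rewrite ?e1 ?e2; ring.
- by apply: (inv s _ _ e3); rewrite ?e1 ?e2; ring.
- by apply: (rot p (-1) (- p) (-1) p _ _ e3) => //; rewrite ?e1 ?e2; ring.
- by apply: (inv p _ _ e3); rewrite ?e1 ?e2; ring.
- by apply: (flip p p 1 _ _ e3) => //; rewrite ?e1 ?e2; ring.
- by apply: (inv s _ _ e3); rewrite ?e1 ?e2; ring.
- by apply: (inv (- r) _ _ e3); rewrite ?e1 ?e2; ring.
- by apply: (inv (- q) _ _ e3); rewrite ?e1 ?e2; ring.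
- by apply: (flip q (- q) 0 _ _ e3) => //; rewrite ?e1 ?e2; ring.
- by apply: (inv 0 0 0) => //; rewrite ?e1 ?e2; ring.
- by apply: (inv 0 0 0) => //; rewrite ?e1 ?e2; ring.
- by apply: (inv 0 0 0) => //; rewrite ?e1 ?e2; ring.
- by apply: (rot q (-1) (- q) 1 0 _ _ e3) => //; rewrite ?e1 ?e2; ring.
- by apply: (inv (- q) _ _ e3); rewrite ?e1 ?e2; ring.
- by apply: (inv s _ _ e3); rewrite ?e1 ?e2; ring.
- by apply: (inv (- r) _ _ e3); rewrite ?e1 ?e2; ring.
- by apply: (rot q 1 (- q) 0 0 _ _ e3) => //; rewrite ?e1 ?e2; ring.
- by apply: (inv (- q) _ _ e3); rewrite ?e1 ?e2; ring.
- by apply: (flip q q 1 _ _ e3) => //; rewrite ?e1 ?e2; ring.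
- by apply: (inv s _ _ e3); rewrite ?e1 ?e2; ring.
- by apply: (inv (- q) _ _ e3); rewrite ?e1 ?e2; ring.
- by apply: (inv 0 0 0) => //; rewrite ?e1 ?e2; ring.
- by apply: (inv 0 0 0) => //; rewrite ?e1 ?e2; ring.
- by apply: (inv 0 0 0) => //; rewrite ?e1 ?e2; ring.
Qed.

(** Suitably scaled spanning vectors of the first two points have their sum in
    the third point.  In the basis that they form, the triple is the frame of
    [frame_perm_F3_trace]. *)
Lemma fix_triple_F3_trace (z : {'GL_2[F]}) (T : {set {set 'rV[F]_2}}) :
  T \in triples F -> PGL2_act_triples F T (coset 'Z('GL_2[F]) z) = T ->
  projective_F3_trace (GLval z).
Proof.
rewrite inE => /andP[/subsetP TP /eqP cT] zT.
have img (v : 'rV[F]_2) : rowg v \in T -> rowg (v *m GLval z) \in T.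
  by move=> vT; rewrite -PGL2_actE -zT; apply: imset_f.
have := enum_uniq (mem T).
have memT L : (L \in enum T) = (L \in T) by rewrite mem_enum.
move: cT memT; rewrite cardE.
case: (enum T) => [|L1 [|L2 [|L3 [|]]]] //= _ memT.
rewrite !inE negb_or => /and3P[/andP[L12 L13] L23 _].
have row_of L : L \in [:: L1; L2; L3] ->
    exists x y, row2 x y != 0 /\ L = rowg (row2 x y).
  rewrite memT => /TP/imsetP[v v0 ->]; have [x [y vE]] := row2P v.
  by exists x, y; rewrite -vE; move: v0; rewrite inE.
have [|a [b [v1 L1E]]] := row_of L1; first by rewrite mem_head.
have [|c [d [v2 L2E]]] := row_of L2; first by rewrite !inE eqxx orbT.
have [|x [y [v3 L3E]]] := row_of L3; first by rewrite !inE eqxx !orbT.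
pose D := a * d - b * c.
have D0 : D != 0 by rewrite subr_eq0 -rowg_row2 // -L1E -L2E.
(* Cramer's rule *)
have [k [m [k0 m0 xE yE]]] : exists k m,
    [/\ k != 0, m != 0, k * a + m * c = x & k * b + m * d = y].
  exists ((x * d - y * c) / D), ((a * y - b * x) / D); split.
  - by rewrite mulf_neq0 ?invr_eq0 // subr_eq0 -rowg_row2 // -L2E -L3E eq_sym.
  - by rewrite mulf_neq0 ?invr_eq0 // subr_eq0 -rowg_row2 // -L1E -L3E.
  - by transitivity (x * (D / D)); [rewrite /D; ring | rewrite divff ?mulr1].
  by transitivity (y * (D / D)); [rewrite /D; ring | rewrite divff ?mulr1].
pose P := mx2 (k * a) (k * b) (m * c) (m * d).
have detP : \det P = k * m * D by rewrite det_mx2 /D; ring.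
have Pu : P \in unitmx.
  by rewrite unitmxE unitfE detP mulf_neq0 ?(mulf_neq0 k0 m0).
have frame1 : rowg (row2 1 0 *m P) = L1.
  have k1 : row2 (k * a) (k * b) != 0.
    by move: v1; rewrite !row2_eq0 !mulf_eq0 (negPf k0).
  rewrite mul_row2 !mul1r !mul0r !addr0 L1E; apply/eqP; rewrite rowg_row2 //.
  by apply/eqP; ring.
have frame2 : rowg (row2 0 1 *m P) = L2.
  have k2 : row2 (m * c) (m * d) != 0.
    by move: v2; rewrite !row2_eq0 !mulf_eq0 (negPf m0).
  rewrite mul_row2 !mul1r !mul0r !add0r L2E; apply/eqP; rewrite rowg_row2 //.
  by apply/eqP; ring.
have frame3 : rowg (row2 1 1 *m P) = L3.
  by rewrite mul_row2 !mul1r L3E xE yE.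
pose N := P *m GLval z *m invmx P.
have frame_img (e : 'rV[F]_2) : rowg (e *m P) \in [:: L1; L2; L3] ->
    [\/ rowg (e *m N) = rowg (row2 1 0), rowg (e *m N) = rowg (row2 0 1) |
        rowg (e *m N) = rowg (row2 1 1)].
  rewrite memT => /img; rewrite -memT !inE.
  have -> : e *m P *m GLval z = e *m N *m P by rewrite /N !mulmxA mulmxKV.
  rewrite -frame1 -frame2 -frame3.
  case/or3P=> /eqP /(rowg_mulr_inj Pu).
  - by constructor 1.
  - by constructor 2.
  by constructor 3.
have zE : GLval z = invmx P *m N *m P.
  by rewrite /N mulmxA mulmxKV // mulKmx.
have detN : \det (GLval z) = \det N.
  rewrite zE (det_mulmx _ P) (det_mulmx _ N) mulrAC -det_mulmx mulVmx //.
  by rewrite det1 mul1r.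
have trN : \tr (GLval z) = \tr N.
  by rewrite zE mxtrace_mulC mulmxA mulmxV // mul1mx.
have N0 : \det N != 0.
  by rewrite -detN -unitfE -unitmxE GL_unitmx.
rewrite /projective_F3_trace detN trN; change (projective_F3_trace N).
have [p [q [r [s NE]]]] := mx2P N; rewrite NE det_mx2 in N0 frame_img *.
have nz (e : 'rV_2) : e != 0 -> e *m mx2 p q r s != 0.
  move=> e0; apply: contraNneq e0 => eN; have Nu : mx2 p q r s \in unitmx.
    by rewrite unitmxE unitfE det_mx2.
  by rewrite -[e](mulmxK Nu) eN mul0mx.
have meets e1 e2 :
    rowg (row2 e1 e2 *m P) \in [:: L1; L2; L3] -> row2 e1 e2 != 0 ->
  let u := e1 * p + e2 * r in let v := e1 * q + e2 * s in
  [\/ v = 0, u = 0 | u = v].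
  move=> /frame_img; rewrite mul_row2 => eN /nz; rewrite mul_row2 => nz0.
  have u0 : [/\ row2 1 0 != 0 :> 'rV[F]_2, row2 0 1 != 0 :> 'rV[F]_2 &
                row2 1 1 != 0 :> 'rV[F]_2].
    by rewrite !row2_eq0 !oner_eq0 !andbF.
  case: u0 => u1 u2 u3.
  case: eN => /eqP; rewrite rowg_row2 // ?mulr1 ?mulr0 => /eqP.
  - by move=> <-; constructor 1.
  - by move=> ->; constructor 2.
  by constructor 3.
have nz10 : row2 1 0 != 0 :> 'rV[F]_2 by rewrite row2_eq0 oner_eq0.
have nz01 : row2 0 1 != 0 :> 'rV[F]_2 by rewrite row2_eq0 oner_eq0 andbF.
have nz11 : row2 1 1 != 0 :> 'rV[F]_2 by rewrite row2_eq0 oner_eq0.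
have m1 := meets 1 0; have m2 := meets 0 1; have m3 := meets 1 1.
rewrite frame1 frame2 frame3 !inE !eqxx ?orbT /= in m1 m2 m3.
rewrite ?mul0r ?mul1r ?add0r ?addr0 in m1 m2 m3.
apply: frame_perm_F3_trace; [exact: N0 | exact: m1 | exact: m2 | exact: m3].
Qed.

End Triples.

(** * The upper bound *)

Section UpperBound.
Variable F : finFieldType.
Notation Z := ('Z('GL_2[F])).
Implicit Types (x y z : {'GL_2[F]}) (A : {set coset_of Z}).

(** The default value 1 is taken at singular matrices. *)
Definition GL2_of (M : 'M[F]_2) : {'GL_2[F]} := insubd (1%g : {'GL_2[F]}) M.

Lemma GL2_ofK (M : 'M[F]_2) : \det M != 0 -> GLval (GL2_of M) = M.
Proof. by rewrite -unitfE => M0; rewrite /GL2_of /= insubdK. Qed.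

Lemma GL2_norm_center x : x \in 'N(Z).
Proof.
apply: (subsetP (normal_norm (center_normal [group of 'GL_2[F]]))).
by rewrite inE.
Qed.

Lemma coset_PGL2 x : coset Z x \in PGL2 F.
Proof. by apply: mem_quotient; rewrite inE. Qed.

Lemma PGL2_coset a : a \in PGL2 F -> exists x, a = coset Z x.
Proof. by case/morphimP=> x _ _ ->; exists x. Qed.

Lemma scalar_center z a : GLval z = a%:M -> z \in Z.
Proof.
move=> zE; apply/centerP; split; first by rewrite inE.
move=> x _; apply: val_inj.
change (GLval z *m GLval x = GLval x *m GLval z).
by rewrite zE scalar_mxC.
Qed.

Lemma coset_scale x z a :
  a != 0 -> GLval x = a *: GLval z -> coset Z x = coset Z z.
Proof.
move=> a0 xE; have detc : \det (a%:M : 'M[F]_2) != 0.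
  by rewrite det_scalar expf_neq0.
have cE := GL2_ofK detc; have cZ := scalar_center cE.
rewrite -[RHS](coset_kerr z cZ); congr coset; apply: val_inj.
change (GLval x = GLval z *m GLval (GL2_of a%:M)).
by rewrite cE mul_mx_scalar.
Qed.

Lemma intersecting_fixes A x y : A \subset PGL2 F ->
  intersecting (PGL2_act_triples F) (triples F) A ->
  coset Z x \in A -> coset Z y \in A ->
  exists2 T, T \in triples F & PGL2_act_triples F T (coset Z (x * y^-1)) = T.
Proof.
move=> AG /forall_inP intA xA yA; have /forall_inP/(_ _ yA) := intA _ xA.
case/exists_inP=> T Tt /eqP xyT; exists T => //.
rewrite morphM ?morphV ?groupV ?GL2_norm_center //.
rewrite actMin ?groupV ?coset_PGL2 // xyT actKin ?coset_PGL2 //.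
Qed.

End UpperBound.

Lemma det_sub1 (R : comNzRingType) (M : 'M[R]_2) :
  \det M = 1 -> \det (M - 1%:M) = 2 - \tr M.
Proof.
have [a [b [c [d ->]]]] := mx2P M.
rewrite scalar_mx2 sub_mx2 !det_mx2 trace_mx2 => e.
by transitivity (a * d - b * c + 1 - (a + d)); [ring | rewrite e; ring].
Qed.

(** Fix a lift y0 of some element of A. The set C of all z of determinant 1
    such that z y0 lies over A gives a clique, and each element of A is hit by
    two opposite elements of C. Hence 2 #|A| <= #|C| <= 4q. *)
Lemma intersecting_card_le (F : finFieldType) (im : F)
    (A : {set coset_of 'Z('GL_2[F])}) :
  3%N \in [pchar F] -> im ^+ 2 = -1 -> (9 <= #|F|)%N -> A \subset PGL2 F ->
  intersecting (PGL2_act_triples F) (triples F) A -> (#|A| <= 2 * #|F|)%N.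
Proof.
move=> ch3 im2 q9 AG intA.
have [-> | [a0 a0A]] := set_0Vmem A; first by rewrite cards0.
have [y0 a0E] := PGL2_coset (subsetP AG _ a0A); rewrite {}a0E in a0A.
have F3tr x y : coset _ x \in A -> coset _ y \in A ->
    projective_F3_trace (GLval (x * y^-1)%g).
  move=> xA yA; have [T Tt xyT] := intersecting_fixes AG intA xA yA.
  exact: (fix_triple_F3_trace ch3 im2 Tt xyT).
pose C := [set z : {'GL_2[F]} | (\det (GLval z) == 1) &&
             (coset 'Z('GL_2[F]) (z * y0)%g \in A)].
have mulE (z w : {'GL_2[F]}) : GLval (z * w)%g = GLval z *m GLval w by [].
have scaled z w a : w \in C -> a ^+ 2 = 1 -> GLval z = a *: GLval w -> z \in C.
  rewrite !inE => /andP[/eqP w1 wA] a2 zE; rewrite zE detZ w1 mulr1 a2 eqxx /=.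
  rewrite (@coset_scale _ _ (w * y0)%g a) //.
    by apply: contra_eq_neq a2 => ->; rewrite expr0n eq_sym oner_eq0.
  by rewrite !mulE zE scalemxAl.
have neg_det : \det (- 1%:M : 'M[F]_2) = 1.
  by rewrite scalar_mx2 opp_mx2 det_mx2; ring.
pose neg (z : {'GL_2[F]}) := (z * GL2_of (- 1%:M))%g.
have negE (z : {'GL_2[F]}) : GLval (neg z) = - GLval z.
  by rewrite mulE GL2_ofK ?neg_det ?oner_eq0 // mulmxN mulmx1.
have negC z : z \in C -> neg z \in C.
  move=> zC; apply: (scaled _ _ (-1) zC); first by rewrite sqrrN expr1n.
  by rewrite negE scaleN1r.
have cS : F3_clique [set GLval z | z in C].
  split=> [_ /imsetP[z + ->] | _ /imsetP[z zC ->]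
          | _ _ /imsetP[z + ->] /imsetP[w + ->]].
  - by rewrite inE => /andP[/eqP].
  - by rewrite -negE; apply/imset_f/negC.
  rewrite !inE => /andP[/eqP z1 zA] /andP[/eqP w1 wA].
  have [l [c [Fc dE tE]]] := F3tr _ _ zA wA.
  have zw : (z * y0 * (w * y0)^-1 = z * w^-1)%g by rewrite invMg mulgA mulgK.
  have zwE : GLval z = GLval (z * w^-1)%g *m GLval w by rewrite -mulE mulgKV.
  have zw1 : \det (GLval (z * w^-1)%g) = 1.
    by rewrite -[LHS]mulr1 -[X in _ * X]w1 -det_mulmx -zwE z1.
  rewrite zw zw1 in dE tE.
  rewrite [GLval z in X in X \is a _]zwE -[X in _ - X]mul1mx -mulmxBl.
  rewrite det_mulmx w1 mulr1.
  rewrite det_sub1 // tE.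
  (* l is 1 or -1 *)
  have [F1 FB FM] := F3_subring ch3.
  have Fl : l \is a F3 F by rewrite qualifE exprS -dE mulr1.
  have -> : 2 - l * c = 1 - (l * c - 1) by ring.
  by apply: FB (FB _ _ _ F1); last exact: FM.
have leC : (#|C| <= 4 * #|F|)%N.
  have := card_F3_clique ch3 im2 q9 cS.
  by rewrite card_imset //; apply: val_inj.
suff : (2 * #|A| <= #|C|)%N.
  by move=> le2A; rewrite -(leq_pmul2l (isT : 0 < 2)%N) mulnA (leq_trans le2A).
rewrite -[X in (_ <= X)%N]sum1_card.
rewrite (partition_big (fun z => coset _ (z * y0)%g) (mem A)) /=; last first.
  by move=> z; rewrite inE => /andP[].
rewrite mulnC -sum_nat_const; apply: leq_sum => a aA; rewrite sum1dep_card.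
have [x aE] := PGL2_coset (subsetP AG _ aA); rewrite {}aE in aA *.
have [l [c [_ dE _]]] := F3tr _ _ aA a0A.
have l0 : l != 0.
  apply: contraTneq (GL_unitmx (x * y0^-1)%g) => l0.
  by rewrite unitmxE dE l0 expr0n unitr0.
pose M := l^-1 *: GLval (x * y0^-1)%g.
have M1 : \det M = 1 by rewrite detZ dE exprVn mulVf ?expf_neq0.
pose z := GL2_of M; have zE : GLval z = M by rewrite GL2_ofK ?M1 ?oner_eq0.
have zx : coset 'Z('GL_2[F]) (z * y0)%g = coset 'Z('GL_2[F]) x.
  apply: (@coset_scale _ _ _ l^-1); rewrite ?invr_eq0 // mulE zE -scalemxAl.
  by rewrite -mulE mulgKV.
have zC : z \in C by rewrite inE zE M1 eqxx zx.
have nzx : coset 'Z('GL_2[F]) (neg z * y0)%g = coset 'Z('GL_2[F]) x.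
  rewrite -zx; apply: (@coset_scale _ _ _ (-1)); rewrite ?oppr_eq0 ?oner_eq0 //.
  by rewrite (mulE (neg z)) negE (mulE z) mulNmx scaleN1r.
have z_neg : z != neg z.
  apply/eqP=> /(congr1 (fun w => GLval w)); rewrite negE => zN.
  suff z0 : GLval z = 0 by move/eqP: M1; rewrite -zE z0 det0 eq_sym oner_eq0.
  have -> : GLval z = 3%:R *: GLval z - (GLval z + GLval z).
    by rewrite scaler_nat !mulrS mulr0n addr0 addrK.
  by rewrite {2}zN addNr subr0 (pcharf0 ch3) scale0r.
have /subset_leq_card : [set z; neg z] \subset
    [set w | (w \in C) &&
       (coset 'Z('GL_2[F]) (w * y0)%g == coset 'Z('GL_2[F]) x)].
  apply/subsetP=> w; rewrite in_set2 in_set => /orP[] /eqP ->.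
    by rewrite zC zx eqxx.
  by rewrite negC // nzx eqxx.
by rewrite cards2 z_neg; apply.
Qed.

(** * A square root of -1, and the numbers of group elements and triples *)

(** The multiplicative group is cyclic, hence has an element of order 4. *)
Lemma sqrtN1_exists (F : finFieldType) : (4 %| #|F|.-1)%N ->
  exists im : F, im ^+ 2 = -1.
Proof.
move=> dv4; have /cyclicP[u uE] := field_unit_group_cyclic [set: {unit F}].
have ou : #[u]%g = #|F|.-1 by rewrite /order -uE card_finField_unit.
have q0 : (0 < #|F|.-1)%N by have := card_finNzRing_gt1 F; case: #|F| => [|[]].
have [n nE] := dvdnP dv4; rewrite nE muln_gt0 andbT in ou q0.
pose i := (u ^+ n)%g.
have oi : #[i]%g = 4 by rewrite orderXdiv ou ?dvdn_mulr // mulKn.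
have i4 : val i ^+ 4 = 1 by rewrite -[4%N]oi -FinRing.val_unitX expg_order.
have i2 : val i ^+ 2 != 1.
  apply/eqP=> i2; have : (i ^+ 2 == 1)%g.
    by apply/eqP/val_inj; rewrite FinRing.val_unitX.
  by rewrite -order_dvdn oi.
exists (val i); apply/eqP; rewrite -addr_eq0.
move/eqP: i4; rewrite -subr_eq0.
rewrite (_ : _ - 1 = (val i ^+ 2 - 1) * (val i ^+ 2 + 1)); last by ring.
by rewrite mulf_eq0 subr_eq0 (negPf i2).
Qed.

Section Cards.
Variable F : finFieldType.
Notation Z := ('Z('GL_2[F])).

Lemma eq_coset_scale (x y : {'GL_2[F]}) : coset Z x = coset Z y ->
  exists2 a, a != 0 & GLval x = a *: GLval y.
Proof.
move=> xy; have /GL2_center_scalar[a a0 aE] : (x * y^-1)%g \in Z.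
  apply: coset_idr; first exact: GL2_norm_center.
  by rewrite morphM ?morphV ?groupV ?GL2_norm_center //= xy mulgV.
exists a => //; rewrite -mul_scalar_mx -aE.
by change (GLval x = GLval (x * y^-1 * y)%g); rewrite mulgKV.
Qed.

Lemma card_GL2_center : #|Z| = #|F|.-1.
Proof.
have dsc (a : F) : a != 0 -> \det (a%:M : 'M[F]_2) != 0.
  by move=> a0; rewrite det_scalar expf_neq0.
rewrite -(cardC1 (0 : F)) -(@card_in_imset _ _ (fun a : F => GL2_of a%:M)).
  apply: eq_card => z.
  apply/idP/imsetP => [/GL2_center_scalar[a a0 zE] | [a a0 ->]].
    exists a => //; apply: val_inj.
    by rewrite -[LHS]/(GLval z) zE -[LHS]GL2_ofK ?dsc.
  by apply: (@scalar_center _ _ a); rewrite GL2_ofK ?dsc.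
move=> a b a0 b0 /(congr1 (fun z => GLval z)).
by rewrite !GL2_ofK ?dsc // !scalar_mx2 => /mx2_inj[].
Qed.

Lemma card_PGL2 : #|PGL2 F| = (#|F|.+1 * #|F| * #|F|.-1)%N.
Proof.
have q0 : (0 < #|F|.-1)%N by have := card_finNzRing_gt1 F; case: #|F| => [|[]].
apply/eqP; rewrite -(eqn_pmul2l q0) -{1}card_GL2_center.
rewrite card_quotient ?normal_norm ?center_normal // Lagrange ?center_sub //.
rewrite card_GL_2; apply/eqP; rewrite -mulnn.
by move: #|F| #|F|.-1 => q p; ring.
Qed.

Lemma card_triples : (#|triples F| * 6 = #|PGL2 F|)%N.
Proof.
rewrite cards_draws card_proj_line card_PGL2.
(* 6 is 3`! *)
rewrite (bin_ffact _ 3) !ffactnS ffactn0 /=.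
by rewrite muln1 mulnA.
Qed.

End Cards.

(** * An intersecting set with 2q elements *)

Section LowerBound.
Variables (F : finFieldType) (ch3 : 3%N \in [pchar F]).
Notation Z := ('Z('GL_2[F])).

(** On the points (1, t), this is the map t |-> b +- t. *)
Definition affine_mx (b : F) (e : bool) : 'M[F]_2 := mx2 1 b 0 ((-1) ^+ e).
Definition affine_GL2 b e : {'GL_2[F]} := GL2_of (affine_mx b e).
Definition signed_translations : {set coset_of Z} :=
  [set coset Z (affine_GL2 p.1 p.2) | p in setT].
Definition pt (t : F) : {set 'rV[F]_2} := rowg (row2 1 t).
Definition F3_line m d : {set {set 'rV[F]_2}} :=
  [set pt m; pt (m + d); pt (m - d)].

Lemma affine_GL2E b e : GLval (affine_GL2 b e) = affine_mx b e.
Proof. by rewrite GL2_ofK // det_mx2 mulr0 subr0 mul1r signr_eq0. Qed.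

Lemma pt_neq0 t : row2 1 t != 0 :> 'rV[F]_2.
Proof. by rewrite row2_eq0 oner_eq0. Qed.

Lemma pt_inj : injective pt.
Proof.
by move=> s t /eqP; rewrite rowg_row2 ?pt_neq0 // mul1r mulr1 => /eqP.
Qed.

Lemma pt_act t b e :
  PGL2_act F (pt t) (coset Z (affine_GL2 b e)) = pt (b + (-1) ^+ e * t).
Proof.
rewrite PGL2_actE affine_GL2E mul_row2; congr (rowg (row2 _ _)); ring.
Qed.

Lemma F3_line_opp m d : F3_line m (- d) = F3_line m d.
Proof. by rewrite /F3_line opprK -setUA [X in _ :|: X]setUC setUA. Qed.

Lemma F3_line_shift m d : F3_line (m + d) d = F3_line m d.
Proof.
rewrite /F3_line addrK (_ : m + d + d = m - d); last first.
  by apply: (eq_mod3 ch3 (z := d)); ring.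
apply/setP=> L; rewrite !inE.
by case: (L == pt m); case: (L == pt (m + d)); case: (L == pt (m - d)).
Qed.

Lemma F3_line_triple m d : d != 0 -> F3_line m d \in triples F.
Proof.
move=> d0; have ptP t : pt t \in proj_line F.
  by apply: imset_f; rewrite inE pt_neq0.
rewrite inE !subUset !sub1set !ptP /= /F3_line setUC cardsU1 cards2.
rewrite !inE !(inj_eq pt_inj).
have e1 : (m + d == m) = false by rewrite -subr_eq0 addrC addKr (negPf d0).
have e2 : (m == m - d) = false.
  by rewrite -subr_eq0 opprB addrC subrK (negPf d0).
have e3 : (m + d == m - d) = false.
  rewrite -subr_eq0 (_ : _ - _ = - d) ?oppr_eq0 ?(negPf d0) //.
  by apply: (eq_mod3 ch3 (z := d)); ring.
by rewrite ![m - d == _]eq_sym [m == m + d]eq_sym e1 e2 e3.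
Qed.

Lemma F3_line_act m d b e :
  PGL2_act_triples F (F3_line m d) (coset Z (affine_GL2 b e)) =
    F3_line (b + (-1) ^+ e * m) d.
Proof.
rewrite /PGL2_act_triples /F3_line /= /setact !imsetU !imset_set1 !pt_act.
case: e; rewrite ?expr0 ?expr1 ?mul1r ?mulN1r ?addrA //.
rewrite -[RHS]F3_line_opp /F3_line; congr [set pt _; pt _; pt _]; ring.
Qed.

Lemma card_signed_translations : #|signed_translations| = (2 * #|F|)%N.
Proof.
rewrite card_imset ?cardsT ?card_prod ?card_bool 1?mulnC //.
move=> -[b e] [b' e'] /=.
case/eq_coset_scale=> a _; rewrite !affine_GL2E scale_mx2 => /mx2_inj[].
rewrite mulr1 => <-; rewrite !mul1r => -> _ ee'; congr (_, _).
have N1 : 1 != -1 :> F.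
  rewrite -subr_eq0 opprK (_ : 1 + 1 = -1) ?oppr_eq0 ?oner_eq0 //.
  by apply: (eq_mod3 ch3 (z := 1)); ring.
move/eqP: ee'; case: e e' => [] [] //=; rewrite expr0 expr1 ?(negPf N1) //.
by rewrite eq_sym (negPf N1).
Qed.

(** If the signs agree, the two maps differ by the translation by d = b - b', so
    they have the same image of the line of step d through 0 (of any line, if
    d = 0).  If the signs are opposite, the maps agree at the solution m of
    b + (-1)^e m = b' - (-1)^e m, which is (-1)^e (b - b') since 1 / 2 = -1.
    They differ by the reflection at m, which preserves {m, m + d, m - d}. *)
Lemma signed_translations_intersecting :
  intersecting (PGL2_act_triples F) (triples F) signed_translations.
Proof.
apply/forall_inP=> _ /imsetP[[b e] _ ->].
apply/forall_inP=> _ /imsetP[[b' e'] _ ->] /=.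
suff [m [d [d0 E]]] : exists m d, d != 0 /\
    F3_line (b + (-1) ^+ e * m) d = F3_line (b' + (-1) ^+ e' * m) d.
  apply/exists_inP; exists (F3_line m d); rewrite ?F3_line_triple //.
  by rewrite !F3_line_act E.
have [ee' | ] := eqVneq e e'.
  exists 0; rewrite !mulr0 !addr0; have [bb' | bb'] := eqVneq b b'.
    by exists 1; rewrite oner_eq0 bb'.
  exists (b - b'); rewrite subr_eq0 bb'; split=> //.
  by rewrite -[RHS]F3_line_shift [b' + _]addrC subrK.
move=> ee; have {ee} -> : e' = ~~ e by case: e e' ee => [] [].
exists ((-1) ^+ e * (b - b')), 1; rewrite oner_eq0.
rewrite mulrA -signr_addb addbb mul1r; split=> //.
rewrite mulrA -signr_addb addNb addbb mulN1r; congr F3_line.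
by apply: (eq_mod3 ch3 (z := b - b')); ring.
Qed.

End LowerBound.

(** * The intersection density *)

Theorem theorem4p2 (l q : nat) (F : finFieldType) (hl : (0 < l)%N)
    (hq : q = (3 ^ (2 * l))%N) (hF : #|F| = q) :
  intersection_density (PGL2_act_triples F) (PGL2 F) (triples F) =
    q%:R / 3%:R.
Proof.
have ch3 : 3%N \in [pchar F].
  by apply: (card_finPcharP (n := (2 * l)%N)); rewrite ?hF.
have q9 : (9 <= #|F|)%N.
  by rewrite hF hq (leq_pexp2l (m := 3) (n1 := 2)) // leq_pmulr.
have [im im2] : exists im : F, im ^+ 2 = -1.
  apply: sqrtN1_exists; rewrite -subn1 -eqn_mod_dvd; last exact: leq_trans q9.
  by rewrite hF hq expnM -modnXm exp1n.
have V0 : #|triples F|%:R != 0 :> rat.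
  rewrite pnatr_eq0 -lt0n -(ltn_pmul2r (isT : 0 < 6)%N) card_triples card_PGL2.
  by rewrite !muln_gt0 /=; case: #|F| q9 => [|[]].
have ratioE (A : {set coset_of 'Z('GL_2[F])}) :
    (#|A| * #|triples F|)%N%:R / #|PGL2 F|%:R = #|A|%:R / 6%:R :> rat.
  by rewrite -card_triples !natrM invfM mulrA mulfK.
have -> : q%:R / 3%:R = (2 * #|F|)%N%:R / 6%:R :> rat.
  by rewrite hF natrM; field.
rewrite /intersection_density; apply/eqP; rewrite eq_le; apply/andP; split.
  apply: bigmax_le => [|A /andP[AG intA]]; first by rewrite divr_ge0 ?ler0n.
  rewrite ratioE ler_pM2r ?invr_gt0 ?ltr0n // ler_nat.
  exact: (intersecting_card_le ch3 im2).
apply: (bigmax_sup (signed_translations F)); last first.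
  by rewrite ratioE card_signed_translations.
rewrite signed_translations_intersecting // andbT.
apply/subsetP=> _ /imsetP[p _ ->].
exact: coset_PGL2.
Qed.
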